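(* Let $E$ be a separable Banach space over $\mathbb{K}\in\{\mathbb{R},\mathbb{C}\}$, let $\mathcal{F}=((a_n,b_n^* ))_{n\in\mathbb{N}^*}$ be a Schauder frame of $E$, and let $((x_n,y_n^* ))_{n\in\mathbb{N}^*}$ be a sequence in $E\times E^*$. Assume that $$\sum_{n=1}^{\infty}\|y_n^*-b_n^*\|_{E^*}\|x_n\|_E+\sum_{n:\,a_n\neq 0}2K_{\mathcal{F}}\frac{\|x_n-a_n\|_E}{\|a_n\|_E}+\sum_{n:\,a_n=0}\|b_n^*\|_{E^*}\|x_n\|_E<1.$$ Then there exist a sequence $(z_n^* )_{n\in\mathbb{N}^*}$ of elements of $E^*$ and a sequence $(w_n)_{n\in\mathbb{N}^*}$ of elements of $E$ such that: (1) $(w_n)_{n\in\mathbb{N}^*}\equiv_E (x_n)_{n\in\mathbb{N}^*}$; (2) $(z_n^* )_{n\in\mathbb{N}^*}\equiv_{E^*}(y_n^* )_{n\in\mathbb{N}^*}$; (3) $((x_n,z_n^* ))_{n\in\mathbb{N}^*}$ and $((w_n,y_n^* ))_{n\in\mathbb{N}^*}$ are Schauder frames of $E$.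
   Context: $E^*$ is the topological dual of $E$ and $\mathbb{N}^*=\{1,2,3,\dots\}$. A sequence $((a_n,b_n^* ))_{n\in\mathbb{N}^*}$ in $E\times E^*$ is a Schauder frame of $E$ if for every $x\in E$ the series $\sum_n b_n^*(x)a_n$ converges in norm to $x$. For a Schauder frame $\mathcal{F}=((a_n,b_n^* ))_{n\in\mathbb{N}^*}$ of $E$, $K_{\mathcal{F}}:=\sup\{\|\sum_{k=1}^n b_k^*(x)a_k\|_E : x\in E,\ \|x\|_E\le 1,\ n\in\mathbb{N}^*\}$, which is a finite quantity. For sequences $(w_n),(x_n)$ in $E$, $(w_n)\equiv_E(x_n)$ means that there is an isomorphism (of Banach spaces) $T$ from $E$ onto $E$ with $w_n=T(x_n)$ for all $n\in\mathbb{N}^*$. For sequences $(z_n^* ),(y_n^* )$ in $E^*$, $(z_n^* )\equiv_{E^*}(y_n^* )$ means that there is an isomorphism $T$ from $E$ onto $E$ with $z_n^*=y_n^*\circ T$ for all $n\in\mathbb{N}^*$. *)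

(* Defs.v *)
(* Stdlib reals with Coquelicot.  Coquelicot's normed modules have real-valued
   norms over any absolute-valued ring K, so that real and complex Banach
   spaces are [CompleteNormedModule K] with K = R_AbsRing or K = C_AbsRing.
   Sequences indexed by {1, 2, 3, ...} are functions on nat, the term of index
   n + 1 being the value at n: [sum_n f n] is thus the sum of the terms of
   indices 1, ..., n + 1, and ranges over all the nonempty partial sums. *)
From Stdlib Require Import Reals ClassicalEpsilon.
From Coquelicot Require Import Coquelicot.

Set Implicit Arguments.
Unset Strict Implicit.

Open Scope R_scope.

(* [is_linear] includes boundedness. *)
Record dual (K : AbsRing) (E : NormedModule K) := Dual {
  dual_fun :> E -> K;
  dual_is_linear : is_linear (dual_fun : E -> AbsRing_NormedModule K)
}.

(* Stated for arbitrary functions because it is also applied to differences of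
   elements of the dual; the supremum is finite for bounded linear forms. *)
Definition dual_norm (K : AbsRing) (E : NormedModule K) (f : E -> K) : R :=
  real (Lub_Rbar (fun r => exists x : E, norm x <= 1 /\ r = abs (f x))).

Definition separable (K : AbsRing) (E : NormedModule K) : Prop :=
  exists d : nat -> E,
    forall (x : E) (eps : R), 0 < eps -> exists n, norm (minus x (d n)) < eps.

Definition is_Schauder_frame (K : AbsRing) (E : NormedModule K)
    (a : nat -> E) (b : nat -> dual E) : Prop :=
  forall x : E, is_series (fun n => scal (b n x) (a n)) x.

(* For a Schauder frame of a Banach space the supremum is finite, by the
   uniform boundedness principle. *)
Definition frame_constant (K : AbsRing) (E : NormedModule K)
    (a : nat -> E) (b : nat -> dual E) : R :=
  real (Lub_Rbar (fun r => exists (x : E) (n : nat),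
    norm x <= 1 /\ r = norm (sum_n (fun k => scal (b k x) (a k)) n))).

(* Sum, in [0, +oo], of the nonnegative numbers f n over the n with P n; the
   partial sums being nondecreasing, [Lim_seq] is their limit. *)
Definition sum_over (P : nat -> Prop) (f : nat -> R) : Rbar :=
  Lim_seq (sum_n (fun n =>
    if excluded_middle_informative (P n) then f n else 0)).

Definition is_isomorphism (K : AbsRing) (E F : NormedModule K) (T : E -> F) :
    Prop :=
  is_linear T /\
  exists S : F -> E, is_linear S /\
    (forall x, S (T x) = x) /\ (forall y, T (S y) = y).

Definition equiv_E (K : AbsRing) (E : NormedModule K) (w x : nat -> E) : Prop :=
  exists T : E -> E, is_isomorphism T /\ forall n, w n = T (x n).

Definition equiv_dual (K : AbsRing) (E : NormedModule K)
    (z y : nat -> dual E) : Prop :=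
  exists T : E -> E, is_isomorphism T /\ forall n v, z n v = y n (T v).

(* Main.v *)
Require Import Defs.
From Stdlib Require Import Reals ClassicalEpsilon Lra.
From Coquelicot Require Import Coquelicot.

(** The frame operator of the perturbed pair, U v = sum_n y_n(v) x_n, is close
    to the identity.  Since v = sum_n b_n(v) a_n, the difference U v - v is
    the sum over n of
      (y_n - b_n)(v) x_n + b_n(v) (x_n - a_n).
    The first summand is at most ||y_n - b_n|| ||x_n|| ||v||.  For the second,
    b_n(v) a_n is the difference of two consecutive partial sums of the frame
    expansion, hence |b_n(v)| ||a_n|| <= 2 K_F ||v||; this gives the bound
    2 K_F ||x_n - a_n|| / ||a_n|| ||v|| if a_n is nonzero, and otherwise the
    summand is b_n(v) x_n, of norm at most ||b_n|| ||x_n|| ||v||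
    ([frame_term_perturbation]).  So the series defining U v converges and
    ||v - U v|| <= q ||v||, where q < 1 is the sum in the hypothesis
    ([perturbed_frame_operator]).  A Neumann series inverts U
    ([near_identity_isomorphism]), and the sequences z_n = y_n o U^-1 and
    w_n = U^-1 x_n answer the question: the frame expansion for (x_n, z_n) is
    U (U^-1 v) = v, the one for (w_n, y_n) is U^-1 (U v) = v.

    The constant K_F is the real part of an extended least upper bound, and
    bounds the partial sums only because that bound is finite.  This is the
    uniform boundedness principle ([uniform_boundedness]), proved here by
    nested balls: if the family were unbounded on the unit ball, each ball
    would contain a smaller one on which some member of the family exceeds a
    prescribed size, and the common point of a decreasing sequence of such
    balls would have an unbounded orbit. *)

(** * Scalars *)

(** Over an arbitrary absolute-valued ring the norm is only submultiplicative
    and vectors cannot be rescaled to norm one.  These two properties of the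
    real and complex numbers restore both facts, and let the two fields be
    treated together. *)
Definition rich_scalars (K : AbsRing) : Prop :=
  (forall k : K, k <> zero -> exists k' : K, mult k' k = one /\ abs k' = / abs k)
  /\ (forall r : R, 0 < r -> exists k : K, abs k = r).

Lemma rich_scalars_R : rich_scalars R_AbsRing.
Proof.
  split.
  - intros k hk. change (k <> 0) in hk. exists (/ k). split.
    + exact (Rinv_l k hk).
    + exact (Rabs_inv k).
  - intros r hr. exists r. exact (Rabs_pos_eq r (Rlt_le _ _ hr)).
Qed.

Lemma rich_scalars_C : rich_scalars C_AbsRing.
Proof.
  split.
  - intros k hk. exists (Cinv k). split.
    + exact (Cinv_l k hk).
    + exact (Cmod_inv k hk).
  - intros r hr. exists (RtoC r).
    change (Cmod (RtoC r) = r). rewrite Cmod_R.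
    exact (Rabs_pos_eq r (Rlt_le _ _ hr)).
Qed.

(** Multiplying back by an inverse of k, whose absolute value is 1 / |k|,
    turns the submultiplicativity of the norm into the reverse inequality. *)
Lemma norm_scal_eq (K : AbsRing) (hK : rich_scalars K) (E : NormedModule K)
    (k : K) (u : E) : norm (scal k u) = abs k * norm u.
Proof.
  apply Rle_antisym; [exact (norm_scal k u)|].
  destruct (excluded_middle_informative (k = zero)) as [->|hk].
  - rewrite abs_zero, Rmult_0_l. apply norm_ge_0.
  - destruct (proj1 hK k hk) as [k' [hk1 hk2]].
    assert (hpos : 0 < abs k).
    { destruct (Rle_lt_or_eq_dec 0 (abs k) (abs_ge_0 k)) as [h|h]; [exact h|].
      elim hk. apply abs_eq_zero. now symmetry. }
    assert (h : norm u <= / abs k * norm (scal k u)).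
    { rewrite <- hk2. rewrite <- (scal_one u) at 1. rewrite <- hk1, <- scal_assoc.
      apply norm_scal. }
    apply (Rmult_le_compat_l (abs k)) in h; [|lra].
    rewrite <- Rmult_assoc, Rinv_r, Rmult_1_l in h; lra.
Qed.

Lemma unit_ball_bound (K : AbsRing) (hK : rich_scalars K) (E F : NormedModule K)
    (T : E -> F) (hT : is_linear T) (C : R)
    (hC : forall v, norm v <= 1 -> norm (T v) <= C) (v : E) :
  norm (T v) <= C * norm v.
Proof.
  destruct (Rle_lt_or_eq_dec 0 (norm v) (norm_ge_0 v)) as [hv|hv].
  - destruct (proj2 hK (/ norm v) (Rinv_0_lt_compat _ hv)) as [k hk].
    assert (h : norm (T (scal k v)) <= C).
    { apply hC. rewrite (norm_scal_eq _ hK), hk, Rinv_l; lra. }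
    rewrite (linear_scal _ hT), (norm_scal_eq _ hK), hk in h.
    apply (Rmult_le_compat_l (norm v)) in h; [|lra].
    rewrite <- Rmult_assoc, Rinv_r, Rmult_1_l in h; lra.
  - assert (v = zero) as -> by (apply norm_eq_zero; now symmetry).
    rewrite (linear_zero _ hT), !norm_zero. lra.
Qed.

(** * Limits and series in normed modules *)

Lemma plus_minus_cancel (G : AbelianGroup) (x y : G) : plus (minus x y) y = x.
Proof.
  unfold minus. now rewrite <- plus_assoc, plus_opp_l, plus_zero_r.
Qed.

Lemma minus_plus_cancel (G : AbelianGroup) (x y : G) : minus (plus x y) y = x.
Proof.
  unfold minus. rewrite <- plus_assoc.
  exact (eq_trans (f_equal (plus x) (plus_opp_r y)) (plus_zero_r x)).
Qed.

Lemma norm_minus_self (K : AbsRing) (E : NormedModule K) (u : E) :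
  norm (minus u u) = 0.
Proof.
  exact (eq_trans (f_equal norm (minus_eq_zero u)) norm_zero).
Qed.

Lemma norm_minus_sym (K : AbsRing) (E : NormedModule K) (u v : E) :
  norm (minus u v) = norm (minus v u).
Proof. now rewrite <- norm_opp, opp_minus. Qed.

Lemma norm_le_minus (K : AbsRing) (E : NormedModule K) (u v : E) :
  norm u <= norm (minus u v) + norm v.
Proof.
  rewrite <- (plus_minus_cancel _ u v) at 1. apply norm_triangle.
Qed.

Lemma norm_le_plus (K : AbsRing) (E : NormedModule K) (u v : E) :
  norm u <= norm (plus u v) + norm v.
Proof.
  rewrite <- (minus_plus_cancel _ u v) at 1. rewrite <- (norm_opp v).
  apply norm_triangle.
Qed.

Lemma norm_minus_triangle (K : AbsRing) (E : NormedModule K) (r u v : E) :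
  norm (minus u v) <= norm (minus u r) + norm (minus r v).
Proof. rewrite (minus_trans r u v). apply norm_triangle. Qed.

(** The bound is itself a sequence so that the lemma serves both for a fixed
    bound and for the partial sums of a dominating series. *)
Lemma norm_limit_le (K : AbsRing) (E : NormedModule K) (u : nat -> E) (l : E)
    (M : nat -> R) (m : R) (hu : filterlim u eventually (locally l))
    (hle : eventually (fun n => norm (u n) <= M n)) (hM : is_lim_seq M m) :
  norm l <= m.
Proof.
  assert (h : is_lim_seq (fun n => norm (u n)) (norm l)).
  { refine (filterlim_comp _ _ _ u norm _ _ _ hu _). apply filterlim_norm. }
  exact (is_lim_seq_le_loc _ _ (norm l) m hle h hM).
Qed.

Lemma norm_series_le (K : AbsRing) (E : NormedModule K) (u : nat -> E) (s : E)
    (c : nat -> R) (q : R) (hu : is_series u s)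
    (hc : forall n, norm (u n) <= c n) (hq : is_series c q) : norm s <= q.
Proof.
  apply (norm_limit_le _ _ _ _ (sum_n c) q hu); [|exact hq].
  exists 0%nat. intros n _. unfold sum_n.
  eapply Rle_trans; [apply norm_sum_n_m|]. now apply sum_n_m_le.
Qed.

Lemma is_series_unique_normed (K : AbsRing) (E : NormedModule K)
    (u : nat -> E) (s t : E) (hs : is_series u s) (ht : is_series u t) : s = t.
Proof. exact (filterlim_locally_unique _ _ _ hs ht). Qed.

Lemma linear_minus (K : AbsRing) (E F : NormedModule K) (T : E -> F)
    (hT : is_linear T) (u v : E) : T (minus u v) = minus (T u) (T v).
Proof.
  unfold minus.
  now rewrite (linear_plus _ hT), linear_opp.
Qed.

Lemma linear_sum_n (K : AbsRing) (E F : NormedModule K) (T : E -> F)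
    (hT : is_linear T) (u : nat -> E) (n : nat) :
  T (sum_n u n) = sum_n (fun k => T (u k)) n.
Proof.
  induction n as [|n IH].
  - now rewrite !sum_O.
  - now rewrite !sum_Sn, (linear_plus _ hT), IH.
Qed.

Lemma linear_series (K : AbsRing) (E F : NormedModule K) (T : E -> F)
    (hT : is_linear T) (u : nat -> E) (s : E) (hs : is_series u s) :
  is_series (fun n => T (u n)) (T s).
Proof.
  apply (filterlim_ext (fun n => T (sum_n u n))).
  - intros n. now apply linear_sum_n.
  - refine (filterlim_comp _ _ _ (sum_n u) T _ _ _ hs _).
    exact (linear_cont T s hT).
Qed.

(** Stating completeness as a property of a normed module, rather than through
    the richer structure, keeps all the module operations of the lemmas below
    in one and the same structure, up to syntax. *)
Definition complete {K : AbsRing} (E : NormedModule K) : Prop :=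
  exists E' : CompleteNormedModule K, CompleteNormedModule.NormedModule K E' = E.

Lemma dominated_series_converges (K : AbsRing) (E : NormedModule K)
    (hE : complete E) (u : nat -> E) (c : nat -> R)
    (hle : forall n, norm (u n) <= c n) (hc : ex_series c) : ex_series u.
Proof.
  destruct hE as [E' <-]. exact (ex_series_le u c hle hc).
Qed.

Lemma cauchy_sequence_converges (K : AbsRing) (E : NormedModule K)
    (hE : complete E) (u : nat -> E)
    (hu : forall eps : posreal, exists N, forall m n,
            (N <= m)%nat -> (N <= n)%nat -> norm (minus (u n) (u m)) < eps) :
  exists l : E, filterlim u eventually (locally l).
Proof.
  destruct hE as [E' <-].
  apply (filterlim_locally_cauchy (U := E') (F := eventually) u).
  intros eps. destruct (hu eps) as [N hN].
  exists (fun n => (N <= n)%nat). split; [now exists N|].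
  intros m n hm hn. apply (norm_compat1 (u m) (u n)). now apply hN.
Qed.

(** * Perturbations of the identity *)

Lemma is_linear_id_minus (K : AbsRing) (E : NormedModule K) (U : E -> E)
    (hU : is_linear U) : is_linear (fun v => minus v (U v)).
Proof.
  apply (is_linear_comp (fun v : E => (v, opp (U v)))
           (fun p => plus (fst p) (snd p))); [|apply is_linear_plus].
  apply is_linear_prod; [apply is_linear_id|].
  apply (is_linear_comp U opp hU). apply is_linear_opp.
Qed.

(** With D = 1 - U, the Neumann series s = sum_n D^n v satisfies D s = s - v,
    by shifting the index, which says that U s = v. *)
Lemma near_identity_surjective (K : AbsRing) (E : NormedModule K) (hE : complete E)
    (U : E -> E) (hU : is_linear U) (q : R) (hq0 : 0 <= q) (hq1 : q < 1)
    (hq : forall v, norm (minus v (U v)) <= q * norm v) (v : E) :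
  exists s, U s = v.
Proof.
  set (D := fun w => minus w (U w)).
  assert (hD : is_linear D) by now apply is_linear_id_minus.
  set (t := fun n => Nat.iter n D v).
  assert (ht : forall n, norm (t n) <= norm v * q ^ n).
  { induction n as [|n IH].
    - simpl pow. rewrite Rmult_1_r. apply Rle_refl.
    - change (t (S n)) with (D (t n)). pose proof (hq (t n) : norm (D (t n)) <= _).
      apply (Rmult_le_compat_l q) in IH; [|lra]. simpl pow. lra. }
  destruct (dominated_series_converges K E hE t (fun n => norm v * q ^ n) ht) as [s hs].
  { apply (ex_series_scal_l (norm v) (fun n => q ^ n)). apply ex_series_geom.
    rewrite Rabs_pos_eq; lra. }
  exists s.
  assert (h1 : is_series (fun n => t (S n)) (D s)) by exact (linear_series _ _ _ D hD t s hs).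
  assert (h2 : is_series (fun n => t (S n)) (minus s v)).
  { apply is_series_incr_1. change (t 0%nat) with v.
    exact (eq_ind_r (is_series t) hs (plus_minus_cancel E s v)). }
  pose proof (is_series_unique_normed _ _ _ _ _ h1 h2) as h.
  unfold D, minus in h. apply plus_reg_l in h.
  now rewrite <- (opp_opp (U s)), h, opp_opp.
Qed.

(** The lower bound ||U v|| >= (1 - q) ||v|| makes U injective, so that the
    linearity of the inverse is inherited from U, and bounds the inverse by
    1 / (1 - q). *)
Lemma near_identity_isomorphism (K : AbsRing) (E : NormedModule K) (hE : complete E)
    (U : E -> E) (hU : is_linear U) (q : R) (hq0 : 0 <= q) (hq1 : q < 1)
    (hq : forall v, norm (minus v (U v)) <= q * norm v) :
  is_isomorphism U.
Proof.
  assert (hbelow : forall v, (1 - q) * norm v <= norm (U v)).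
  { intros v. pose proof (norm_le_minus K E v (U v)). pose proof (hq v). lra. }
  assert (hinj : forall u v, U u = U v -> u = v).
  { intros u v h.
    pose proof (hbelow (minus u v)) as hb.
    rewrite (linear_minus _ _ _ _ hU), h, norm_minus_self in hb.
    assert (h0 : minus u v = zero).
    { apply norm_eq_zero. pose proof (norm_ge_0 (minus u v)). nra. }
    now rewrite <- (plus_minus_cancel _ u v), h0, plus_zero_l. }
  pose (S := fun v => proj1_sig (constructive_indefinite_description _
               (near_identity_surjective _ _ hE U hU q hq0 hq1 hq v))).
  assert (hUS : forall v, U (S v) = v).
  { intros v. unfold S. apply proj2_sig. }
  split; [exact hU|]. exists S. split; [|split].
  - split.
    + intros u v. apply hinj. now rewrite (linear_plus _ hU), !hUS.
    + intros k v. apply hinj. now rewrite (linear_scal _ hU), !hUS.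
    + exists (/ (1 - q)). split; [apply Rinv_0_lt_compat; lra|].
      intros v. pose proof (hbelow (S v)) as h. rewrite hUS in h.
      apply (Rmult_le_reg_l (1 - q)); [lra|].
      rewrite <- Rmult_assoc, Rinv_r, Rmult_1_l; lra.
  - intros v. apply hinj. apply hUS.
  - exact hUS.
Qed.

(** * Uniform boundedness *)

(** The step hypothesis says that the closed ball of center c (n + 1) and radius
    r (n + 1) lies in the preceding one in the strong sense that survives
    summation: distances of centers are then bounded by differences of radii. *)
Lemma nested_balls (K : AbsRing) (E : NormedModule K) (hE : complete E) (c : nat -> E)
    (r : nat -> R) (hr0 : forall n, 0 <= r n)
    (hstep : forall n, norm (minus (c (S n)) (c n)) + r (S n) <= r n)
    (hr : is_lim_seq r 0) :
  exists x : E, forall n, norm (minus x (c n)) <= r n.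
Proof.
  assert (hcn : forall n m, (n <= m)%nat -> norm (minus (c m) (c n)) <= r n - r m).
  { intros n m hnm. induction hnm as [|m hnm IH].
    - rewrite norm_minus_self. lra.
    - pose proof (norm_minus_triangle _ _ (c m) (c (S m)) (c n)).
      pose proof (hstep m). lra. }
  assert (hlim : exists x : E, filterlim c eventually (locally x)).
  { apply (cauchy_sequence_converges K E hE). intros eps.
    pose proof (proj2 (is_lim_seq_spec r 0) hr (pos_div_2 eps)) as [N hN].
    exists N. intros m n hm hn.
    pose proof (norm_minus_triangle _ _ (c N) (c n) (c m)) as h.
    rewrite (norm_minus_sym _ _ (c N) (c m)) in h.
    pose proof (hcn N m hm). pose proof (hcn N n hn).
    pose proof (hr0 m). pose proof (hr0 n).
    specialize (hN N (Nat.le_refl N)). simpl in hN.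
    rewrite Rminus_0_r, (Rabs_pos_eq _ (hr0 N)) in hN. lra. }
  destruct hlim as [x hx]. exists x. intros n.
  apply (norm_limit_le K E (fun m => minus (c m) (c n)) (minus x (c n))
           (fun _ => r n)).
  - unfold minus.
    refine (filterlim_comp_2 c (fun _ => opp (c n)) plus hx
              (filterlim_const _) _).
    apply (filterlim_plus x (opp (c n))).
  - exists n. intros m hm. pose proof (hcn n m hm). pose proof (hr0 m). lra.
  - apply is_lim_seq_const.
Qed.

(** Were the family unbounded, any ball could be shrunk, at each stage k, to a
    ball of at most half its radius on which some T_i has norm at least k.  No
    bound could then hold at the common point of these balls. *)
Lemma uniform_boundedness (K : AbsRing) (hK : rich_scalars K)
    (E : NormedModule K) (hE : complete E) (F : NormedModule K) (I : Type)
    (T : I -> E -> F) (hT : forall i, is_linear (T i))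
    (hpt : forall v, exists M, forall i, norm (T i v) <= M) :
  exists M, forall i v, norm v <= 1 -> norm (T i v) <= M.
Proof.
  apply NNPP. intros hno.
  assert (hbig : forall M, exists i v, norm v <= 1 /\ M < norm (T i v)).
  { intros M. apply NNPP. intros h. apply hno. exists M. intros i v hv.
    apply Rnot_lt_le. intros hlt. apply h. now exists i, v. }
  assert (hstep : forall (k : nat) (p : E * R), exists p' : E * R,
    0 < snd p ->
      0 < snd p' /\ snd p' <= snd p / 2 /\
      norm (minus (fst p') (fst p)) <= snd p / 2 /\
      exists i, forall y, norm (minus y (fst p')) <= snd p' ->
        INR k <= norm (T i y)).
  { intros k [x r]. simpl.
    destruct (Rlt_dec 0 r) as [hr|hr]; [|exists (x, r); intros h; now elim hr].
    (* The displacement l v, of norm at most r / 2, has an image of norm more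
       than 2 (k + 1); so at x or at x + l v the image exceeds k + 1. *)
    destruct (hbig (2 * (INR k + 1) / (r / 2))) as [i [v [hv hiv]]].
    destruct (proj2 hK (r / 2) ltac:(lra)) as [l hl].
    assert (hlv : 2 * (INR k + 1) < norm (T i (scal l v))).
    { rewrite (linear_scal _ (hT i)), (norm_scal_eq _ hK), hl.
      apply (Rmult_lt_compat_l (r / 2)) in hiv; [|lra].
      replace (r / 2 * (2 * (INR k + 1) / (r / 2))) with (2 * (INR k + 1)) in hiv
        by (field; lra).
      exact hiv. }
    assert (hx' : exists x', norm (minus x' x) <= r / 2 /\
                             INR k + 1 < norm (T i x')).
    { destruct (Rlt_dec (INR k + 1) (norm (T i x))) as [h|h].
      - exists x. rewrite norm_minus_self. split; [lra|exact h].
      - exists (plus (scal l v) x).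
        split.
        + rewrite minus_plus_cancel, (norm_scal_eq _ hK), hl.
          pose proof (norm_ge_0 v). nra.
        + rewrite (linear_plus _ (hT i)).
          pose proof (norm_le_plus _ _ (T i (scal l v)) (T i x)). lra. }
    destruct hx' as [x' [hx1 hx2]].
    destruct (linear_norm _ (hT i)) as [L [hL hTL]].
    (* Within distance 1 / L the value of T_i varies by at most 1. *)
    exists (x', Rmin (r / 2) (/ L)). intros _. simpl.
    split; [|split; [|split; [exact hx1|exists i]]].
    - apply Rmin_pos; [lra|]. now apply Rinv_0_lt_compat.
    - apply Rmin_l.
    - intros y hy.
      assert (hy' : L * norm (minus x' y) <= 1).
      { rewrite norm_minus_sym. apply (Rmult_le_reg_l (/ L)).
        - now apply Rinv_0_lt_compat.
        - rewrite <- Rmult_assoc, Rinv_l, Rmult_1_l, Rmult_1_r by lra.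
          eapply Rle_trans; [exact hy|]. apply Rmin_r. }
      pose proof (hTL (minus x' y)) as h. rewrite (linear_minus _ _ _ _ (hT i)) in h.
      pose proof (norm_le_minus _ _ (T i x') (T i y)). lra. }
  pose (step := fun k p => proj1_sig (constructive_indefinite_description _ (hstep k p))).
  assert (hs : forall k p, 0 < snd p ->
      0 < snd (step k p) /\ snd (step k p) <= snd p / 2 /\
      norm (minus (fst (step k p)) (fst p)) <= snd p / 2 /\
      exists i, forall y, norm (minus y (fst (step k p))) <= snd (step k p) ->
        INR k <= norm (T i y)).
  { intros k p. unfold step. apply proj2_sig. }
  pose (B := nat_rect (fun _ => (E * R)%type) (zero, 1) step).
  assert (hB : forall n, 0 < snd (B n) <= (/ 2) ^ n).
  { induction n as [|n IH].
    - simpl. lra.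
    - destruct (hs n (B n) (proj1 IH)) as [h1 [h2 _]].
      change (B (S n)) with (step n (B n)). simpl pow. lra. }
  destruct (nested_balls K E hE (fun n => fst (B n)) (fun n => snd (B n))) as [x hx].
  - intros n. apply Rlt_le, hB.
  - intros n. destruct (hs n (B n) (proj1 (hB n))) as [_ [h2 [h3 _]]].
    change (B (S n)) with (step n (B n)). lra.
  - apply (is_lim_seq_le_le (fun _ => 0) _ (fun n => (/ 2) ^ n)).
    + intros n. split; [apply Rlt_le|]; apply hB.
    + apply is_lim_seq_const.
    + apply is_lim_seq_geom. rewrite Rabs_pos_eq; lra.
  - destruct (hpt x) as [M hM].
    destruct (INR_unbounded M) as [n hn].
    destruct (hs n (B n) (proj1 (hB n))) as [_ [_ [_ [i hi]]]].
    specialize (hi x (hx (S n))). specialize (hM i). lra.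
Qed.

(** * Norms defined by least upper bounds *)

(** The real part of an infinite least upper bound is the default value 0, so
    an upper bound M must be known to exist. *)
Lemma le_real_Lub (P : R -> Prop) (M r : R) (hM : forall s, P s -> s <= M)
    (hr : P r) : r <= real (Lub_Rbar P).
Proof.
  destruct (Lub_Rbar_correct P) as [hub hlub].
  specialize (hub r hr). specialize (hlub M hM).
  destruct (Lub_Rbar P); simpl in *; [exact hub|tauto|tauto].
Qed.

Lemma dual_norm_bound (K : AbsRing) (hK : rich_scalars K) (E : NormedModule K)
    (f : E -> K) (hf : is_linear (f : E -> AbsRing_NormedModule K)) (v : E) :
  abs (f v) <= dual_norm f * norm v.
Proof.
  apply (unit_ball_bound K hK E (AbsRing_NormedModule K) f hf).
  intros u hu. destruct (linear_norm _ hf) as [M [hM0 hM]].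
  apply (le_real_Lub _ M).
  - intros r [w [hw ->]]. eapply Rle_trans; [exact (hM w)|].
    pose proof (norm_ge_0 w). nra.
  - now exists u.
Qed.

Lemma dual_norm_ge_0 (K : AbsRing) (E : NormedModule K) (f : E -> K)
    (hf : is_linear (f : E -> AbsRing_NormedModule K)) : 0 <= dual_norm f.
Proof.
  destruct (linear_norm _ hf) as [M [hM0 hM]].
  apply Rle_trans with (abs (f zero)); [apply abs_ge_0|].
  apply (le_real_Lub _ M).
  - intros r [w [hw ->]]. eapply Rle_trans; [exact (hM w)|].
    pose proof (norm_ge_0 w). nra.
  - exists zero. rewrite norm_zero. split; [lra|easy].
Qed.

Lemma is_linear_dual_minus (K : AbsRing) (E : NormedModule K) (f g : dual E) :
  is_linear ((fun v => minus (f v) (g v)) : E -> AbsRing_NormedModule K).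
Proof.
  apply (is_linear_comp
           (fun v => (f v, opp (g v)) : AbsRing_NormedModule K * AbsRing_NormedModule K)
           (fun p => plus (fst p) (snd p))); [|apply is_linear_plus].
  apply (is_linear_prod (V := AbsRing_NormedModule K)
           (f : E -> AbsRing_NormedModule K) (fun v => opp (g v)));
    [apply dual_is_linear|].
  apply (is_linear_comp (g : E -> AbsRing_NormedModule K) opp);
    [apply dual_is_linear|apply is_linear_opp].
Qed.

(** * Frame expansions and their perturbations *)

Lemma is_linear_rank_one (K : AbsRing) (E : NormedModule K) (f : dual E) (u : E) :
  is_linear (fun v : E => scal (f v) u).
Proof.
  apply (is_linear_comp (f : E -> AbsRing_NormedModule K) (fun l => scal l u)).
  - apply dual_is_linear.
  - apply is_linear_scal_l.
Qed.

Lemma is_linear_partial_sum (K : AbsRing) (E : NormedModule K) (a : nat -> E)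
    (b : nat -> dual E) (n : nat) :
  is_linear (fun v => sum_n (fun k => scal (b k v) (a k)) n).
Proof.
  induction n as [|n IH].
  - eapply is_linear_ext; [|exact (is_linear_rank_one K E (b 0%nat) (a 0%nat))].
    intros v. now rewrite sum_O.
  - eapply is_linear_ext.
    + intros v. symmetry. apply sum_Sn.
    + apply (is_linear_comp
        (fun v => (sum_n (fun k => scal (b k v) (a k)) n, scal (b (S n) v) (a (S n))))
        (fun p => plus (fst p) (snd p))); [|apply is_linear_plus].
      apply is_linear_prod; [exact IH|apply is_linear_rank_one].
Qed.

Lemma partial_sum_bound (K : AbsRing) (hK : rich_scalars K)
    (E : NormedModule K) (hE : complete E) (a : nat -> E) (b : nat -> dual E)
    (hF : is_Schauder_frame a b) (n : nat) (v : E) :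
  norm (sum_n (fun k => scal (b k v) (a k)) n) <= frame_constant a b * norm v.
Proof.
  destruct (uniform_boundedness K hK E hE E nat
              (fun n v => sum_n (fun k => scal (b k v) (a k)) n)) as [M hM].
  - intros i. apply is_linear_partial_sum.
  - intros u.
    destruct (filterlim_bounded (sum_n (fun k => scal (b k u) (a k)))) as [M hM].
    + exists u. exact (hF u).
    + now exists M.
  - apply (unit_ball_bound K hK E E _ (is_linear_partial_sum K E a b n)).
    intros u hu. apply (le_real_Lub _ M).
    + intros r [w [m [hw ->]]]. now apply hM.
    + now exists u, n.
Qed.

(** A term is the difference of two consecutive partial sums, each at most
    K_F ||v||: this is where the factor 2 comes from. *)
Lemma frame_term_bound (K : AbsRing) (hK : rich_scalars K)
    (E : NormedModule K) (hE : complete E) (a : nat -> E) (b : nat -> dual E)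
    (hF : is_Schauder_frame a b) (n : nat) (v : E) :
  abs (b n v) * norm (a n) <= 2 * frame_constant a b * norm v.
Proof.
  rewrite <- (norm_scal_eq K hK).
  pose proof (partial_sum_bound K hK E hE a b hF) as hS.
  destruct n as [|n].
  - pose proof (hS 0%nat v) as h. rewrite sum_O in h.
    pose proof (norm_ge_0 (scal (b 0%nat v) (a 0%nat))). lra.
  - pose proof (hS n v) as h1. pose proof (hS (S n) v) as h2.
    rewrite sum_Sn in h2.
    set (s := sum_n (fun k => scal (b k v) (a k)) n) in *.
    set (t := scal (b (S n) v) (a (S n))) in *.
    assert (h : norm t <= frame_constant a b * norm v + norm s).
    { eapply Rle_trans; [apply (norm_le_plus _ _ t s)|]. apply Rplus_le_compat_r.
      exact (eq_ind _ (fun u => norm u <= _) h2 _ (plus_comm s t)). }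
    lra.
Qed.

Lemma frame_constant_ge_0 (K : AbsRing) (hK : rich_scalars K)
    (E : NormedModule K) (hE : complete E) (a : nat -> E) (b : nat -> dual E)
    (hF : is_Schauder_frame a b) (v : E) (hv : v <> zero) :
  0 <= frame_constant a b.
Proof.
  pose proof (partial_sum_bound K hK E hE a b hF 0 v) as h.
  pose proof (norm_ge_0 (sum_n (fun k => scal (b k v) (a k)) 0)).
  pose proof (norm_gt_0 v hv). nra.
Qed.

(** The partial sums of nonnegative terms are nondecreasing, hence have a limit,
    which is infinite unless the series converges. *)
Lemma sum_over_cases (P : nat -> Prop) (f : nat -> R)
    (hf : forall n, P n -> 0 <= f n) :
  sum_over P f = p_infty \/
  exists s : R, 0 <= s /\ sum_over P f = Finite s /\
    is_series (fun n => if excluded_middle_informative (P n) then f n else 0) s.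
Proof.
  unfold sum_over.
  set (g := fun n => if excluded_middle_informative (P n) then f n else 0).
  assert (hg : forall n, 0 <= g n).
  { intros n. unfold g. destruct excluded_middle_informative; [auto|lra]. }
  assert (hS : forall n, 0 <= sum_n g n).
  { induction n as [|n IH]; [now rewrite sum_O|].
    rewrite sum_Sn. specialize (hg (S n)).
    change (0 <= sum_n g n + g (S n)). lra. }
  assert (hl : is_lim_seq (sum_n g) (Lim_seq (sum_n g))).
  { apply Lim_seq_correct, ex_lim_seq_incr. intros n. rewrite sum_Sn.
    specialize (hg (S n)). change (sum_n g n <= sum_n g n + g (S n)). lra. }
  assert (h0 : Rbar_le 0 (Lim_seq (sum_n g))).
  { exact (is_lim_seq_le (fun _ => 0) _ 0 _ hS (is_lim_seq_const 0) hl). }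
  destruct (Lim_seq (sum_n g)) as [s| |] eqn:hs; [right|now left|contradiction].
  exists s. split; [exact h0|]. split; [exact hs|exact hl].
Qed.

Lemma sum_over_three (P1 P2 P3 : nat -> Prop) (f1 f2 f3 : nat -> R)
    (hf1 : forall n, P1 n -> 0 <= f1 n) (hf2 : forall n, P2 n -> 0 <= f2 n)
    (hf3 : forall n, P3 n -> 0 <= f3 n) (m : R)
    (hlt : Rbar_lt (Rbar_plus (Rbar_plus (sum_over P1 f1) (sum_over P2 f2))
                      (sum_over P3 f3)) m) :
  exists q : R, 0 <= q /\ q < m /\
    is_series (fun n =>
      (if excluded_middle_informative (P1 n) then f1 n else 0) +
      (if excluded_middle_informative (P2 n) then f2 n else 0) +
      (if excluded_middle_informative (P3 n) then f3 n else 0)) q.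
Proof.
  destruct (sum_over_cases P1 f1 hf1) as [e1|[s1 [p1 [e1 h1]]]];
  destruct (sum_over_cases P2 f2 hf2) as [e2|[s2 [p2 [e2 h2]]]];
  destruct (sum_over_cases P3 f3 hf3) as [e3|[s3 [p3 [e3 h3]]]];
  rewrite e1, e2, e3 in hlt; simpl in hlt; try contradiction.
  exists (s1 + s2 + s3). split; [lra|]. split; [exact hlt|].
  exact (is_series_plus _ _ _ _ (is_series_plus _ _ _ _ h1 h2) h3).
Qed.

(** The term-by-term differences of the two expansions are dominated by the
    series of the c n, so the second expansion converges with the first, to a
    vector at distance at most q ||v|| from v.  Linearity of the sum U v in v
    follows from uniqueness of limits. *)
Lemma perturbed_frame_operator (K : AbsRing)
    (E : NormedModule K) (hE : complete E) (a : nat -> E) (b : nat -> dual E)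
    (hF : is_Schauder_frame a b) (x : nat -> E) (y : nat -> dual E)
    (c : nat -> R) (q : R) (hc : is_series c q)
    (hd : forall n v, norm (minus (scal (b n v) (a n)) (scal (y n v) (x n)))
                      <= c n * norm v) :
  exists U : E -> E, is_linear U /\
    (forall v, norm (minus v (U v)) <= q * norm v) /\
    (forall v, is_series (fun n => scal (y n v) (x n)) (U v)).
Proof.
  assert (hcv : forall v : E, is_series (fun n => c n * norm v) (q * norm v)).
  { intros v. apply (is_series_ext (fun n => scal (norm v) (c n))).
    - intros n. apply Rmult_comm.
    - rewrite Rmult_comm. exact (is_series_scal (norm v) c q hc). }
  assert (hex : forall v, exists u, is_series (fun n => scal (y n v) (x n)) u).
  { intros v.
    destruct (dominated_series_converges K E hE _ _ (fun n => hd n v) (ex_intro _ _ (hcv v))) as [d hdv].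
    exists (minus v d).
    eapply is_series_ext; [|exact (is_series_minus _ _ _ _ (hF v) hdv)].
    intros n. change (minus (scal (b n v) (a n))
      (minus (scal (b n v) (a n)) (scal (y n v) (x n))) = scal (y n v) (x n)).
    unfold minus at 1. rewrite opp_minus, plus_comm. apply plus_minus_cancel. }
  pose (U := fun v => proj1_sig (constructive_indefinite_description _ (hex v))).
  assert (hU : forall v, is_series (fun n => scal (y n v) (x n)) (U v)).
  { intros v. unfold U. apply proj2_sig. }
  assert (hUq : forall v, norm (minus v (U v)) <= q * norm v).
  { intros v.
    apply (norm_series_le K E _ _ (fun n => c n * norm v) _
             (is_series_minus _ _ _ _ (hF v) (hU v)) (fun n => hd n v) (hcv v)). }
  exists U. split; [split|split; assumption].
  - intros u v.
    apply (is_series_unique_normed K E _ _ _ (hU (plus u v))).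
    eapply is_series_ext; [|exact (is_series_plus _ _ _ _ (hU u) (hU v))].
    intros n. symmetry. apply (linear_plus _ (is_linear_rank_one K E (y n) (x n))).
  - intros k v.
    apply (is_series_unique_normed K E _ _ _ (hU (scal k v))).
    eapply is_series_ext; [|exact (is_series_scal k _ _ (hU v))].
    intros n. symmetry. apply (linear_scal _ (is_linear_rank_one K E (y n) (x n))).
  - exists (1 + Rabs q). pose proof (Rabs_pos q). split; [lra|].
    intros v. pose proof (norm_le_minus _ _ (U v) v) as h.
    rewrite norm_minus_sym in h. pose proof (hUq v).
    pose proof (Rle_abs q). pose proof (norm_ge_0 v). nra.
Qed.

(** The intermediate vector b_n(v) x_n splits the difference into a change of
    functional and a change of vector; the latter is measured relatively to
    ||a_n||, which [frame_term_bound] controls, except where a_n vanishes. *)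
Lemma frame_term_perturbation (K : AbsRing) (hK : rich_scalars K)
    (E : NormedModule K) (hE : complete E) (a : nat -> E) (b : nat -> dual E)
    (hF : is_Schauder_frame a b) (x : nat -> E) (y : nat -> dual E)
    (n : nat) (v : E) :
  norm (minus (scal (b n v) (a n)) (scal (y n v) (x n))) <=
  ((if excluded_middle_informative True
    then dual_norm (fun v : E => minus (y n v) (b n v)) * norm (x n) else 0) +
   (if excluded_middle_informative (a n <> zero)
    then 2 * frame_constant a b * (norm (minus (x n) (a n)) / norm (a n)) else 0) +
   (if excluded_middle_informative (a n = zero)
    then dual_norm (b n) * norm (x n) else 0)) * norm v.
Proof.
  destruct (excluded_middle_informative True) as [_|hT]; [|tauto].
  rewrite norm_minus_sym.
  pose proof (norm_minus_triangle _ _ (scal (b n v) (x n))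
                (scal (y n v) (x n)) (scal (b n v) (a n))) as h.
  assert (h1 : norm (minus (G := NormedModule.AbelianGroup K E)
                 (scal (y n v) (x n)) (scal (b n v) (x n))) <=
               abs (minus (y n v) (b n v)) * norm (x n)).
  { exact (eq_ind _ (fun u : E => norm u <= _) (norm_scal _ _) _
             (scal_minus_distr_r (y n v) (b n v) (x n))). }
  assert (h2 : norm (minus (G := NormedModule.AbelianGroup K E)
                 (scal (b n v) (x n)) (scal (b n v) (a n))) <=
               abs (b n v) * norm (minus (x n) (a n))).
  { exact (eq_ind _ (fun u : E => norm u <= _) (norm_scal _ _) _
             (scal_minus_distr_l (b n v) (x n) (a n))). }
  assert (h3 : abs (minus (y n v) (b n v)) * norm (x n) <=
               dual_norm (fun v : E => minus (y n v) (b n v)) * norm v * norm (x n)).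
  { apply Rmult_le_compat_r; [apply norm_ge_0|].
    exact (dual_norm_bound K hK E _ (is_linear_dual_minus K E (y n) (b n)) v). }
  enough (h4 : abs (b n v) * norm (minus (x n) (a n)) <=
   ((if excluded_middle_informative (a n <> zero)
    then 2 * frame_constant a b * (norm (minus (x n) (a n)) / norm (a n)) else 0) +
   (if excluded_middle_informative (a n = zero)
    then dual_norm (b n) * norm (x n) else 0)) * norm v) by lra.
  destruct (excluded_middle_informative (a n = zero)) as [ha|ha];
    destruct (excluded_middle_informative (a n <> zero)) as [ha'|ha']; try tauto.
  - replace (norm (minus (x n) (a n))) with (norm (x n))
      by (rewrite ha; exact (f_equal norm (eq_sym (minus_zero_r (x n))))).
    pose proof (dual_norm_bound K hK E _ (dual_is_linear (b n)) v) as h5.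
    apply (Rmult_le_compat_r (norm (x n))) in h5; [|apply norm_ge_0]. lra.
  - pose proof (norm_gt_0 _ ha) as hpos.
    pose proof (frame_term_bound K hK E hE a b hF n v) as h5.
    apply (Rmult_le_compat_r (norm (minus (x n) (a n)) / norm (a n))) in h5.
    + replace (abs (b n v) * norm (minus (x n) (a n))) with
        (abs (b n v) * norm (a n) * (norm (minus (x n) (a n)) / norm (a n)))
        by (field; lra).
      lra.
    + apply Rmult_le_pos; [apply norm_ge_0|].
      apply Rlt_le, Rinv_0_lt_compat, hpos.
Qed.

Theorem theorem1 (K : AbsRing) (hK : K = R_AbsRing \/ K = C_AbsRing)
    (E : CompleteNormedModule K) (hE : separable E)
    (a : nat -> E) (b : nat -> dual E) (hF : is_Schauder_frame a b)
    (x : nat -> E) (y : nat -> dual E)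
    (hsum : Rbar_lt
      (Rbar_plus (Rbar_plus
        (sum_over (fun _ => True)
          (fun n => dual_norm (fun v : E => minus (y n v) (b n v)) * norm (x n)))
        (sum_over (fun n => a n <> zero)
          (fun n => 2 * frame_constant a b *
                    (norm (minus (x n) (a n)) / norm (a n)))))
        (sum_over (fun n => a n = zero)
          (fun n => dual_norm (b n) * norm (x n))))
      1) :
  exists (z : nat -> dual E) (w : nat -> E),
    equiv_E w x /\
    equiv_dual z y /\
    is_Schauder_frame x z /\
    is_Schauder_frame w y.
Proof.
  assert (hK' : rich_scalars K).
  { destruct hK as [->| ->]; [exact rich_scalars_R|exact rich_scalars_C]. }
  clear hK hE.
  assert (hE : complete E) by now exists E.
  assert (hpos : forall n, a n <> zero ->
    0 <= 2 * frame_constant a b * (norm (minus (x n) (a n)) / norm (a n))).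
  { intros n ha. apply Rmult_le_pos.
    - pose proof (frame_constant_ge_0 K hK' E hE a b hF (a n) ha). lra.
    - apply Rmult_le_pos; [apply norm_ge_0|].
      apply Rlt_le, Rinv_0_lt_compat, norm_gt_0, ha. }
  destruct (sum_over_three _ _ _ _ _ _
    (fun n _ => Rmult_le_pos _ _
       (dual_norm_ge_0 K E _ (is_linear_dual_minus K E (y n) (b n)))
       (norm_ge_0 (x n)))
    hpos
    (fun n _ => Rmult_le_pos _ _
       (dual_norm_ge_0 K E _ (dual_is_linear (b n))) (norm_ge_0 (x n))) 1 hsum)
    as [q [hq0 [hq1 hq]]].
  destruct (perturbed_frame_operator K E hE a b hF x y _ q hq
              (frame_term_perturbation K hK' E hE a b hF x y))
    as [U [hUlin [hUq hser]]].
  pose proof (near_identity_isomorphism K E hE U hUlin q hq0 hq1 hUq) as hUiso.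
  destruct hUiso as [_ [S [hSlin [hSU hUS]]]].
  assert (hS : is_isomorphism S) by (split; [exact hSlin|now exists U]).
  exists (fun n => Dual (is_linear_comp S (y n : E -> AbsRing_NormedModule K)
                           hSlin (dual_is_linear (y n)))).
  exists (fun n => S (x n)).
  split; [|split; [|split]].
  - now exists S.
  - now exists S.
  - intros v. simpl. pose proof (hser (S v)) as h. now rewrite hUS in h.
  - intros v.
    pose proof (linear_series K E E S hSlin _ _ (hser v)) as h. rewrite hSU in h.
    eapply is_series_ext; [|exact h].
    intros n. apply (linear_scal _ hSlin).
Qed.
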